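(* Let $\mathcal{A}=\{A_0,A_1,A_2\}$ be the standard basis of a symmetric rank $3$ standard integral table algebra with character table $[1,k,\ell;\,1,r,-1-r;\,1,s,-1-s]$. (i) If $k=r(3+r)$, $\ell=3+r$ and $s=-2$, then the partition $249|35678$ of $\{2,\dots,9\}$ gives a fusion of $\mathcal{A}\otimes\mathcal{A}$. (ii) If $\ell=-k(s+1)$, $k=2-s$ and $r=1$, then the partition $24689|357$ gives a fusion of $\mathcal{A}\otimes\mathcal{A}$.
   Context: A symmetric rank $3$ standard integral table algebra is a commutative associative complex algebra with basis $A_0=1,A_1,A_2$ such that the structure constants $\lambda_{ijh}$ ($A_iA_j=\sum_h\lambda_{ijh}A_h$) are nonnegative reals, $\lambda_{ij0}=0$ for $i\neq j$, and $\lambda_{ii0}=\delta(A_i)$ is a positive integer, where $\delta$ is the valency homomorphism. Main example: $A_0=I_n$, $A_1$ the adjacency matrix of a strongly regular graph, $A_2=J-I-A_1$. Here $k=\delta(A_1)$, $\ell=\delta(A_2)$, and the character table has rows the characters $\chi_0=\delta,\chi_1,\chi_2$ and columns $A_0,A_1,A_2$. The tensor square $\mathcal{A}\otimes\mathcal{A}$ has basis $A_{ij}=A_i\otimes A_j$, relabelled $C_{3j+i+1}=A_{ij}$: $C_1=A_{00},C_2=A_{10},C_3=A_{20},C_4=A_{01},C_5=A_{11},C_6=A_{21},C_7=A_{02},C_8=A_{12},C_9=A_{22}$. Partitions of $\{2,\dots,9\}$ are written with blocks separated by bars. A partition $\tau$ gives a fusion of $\mathcal{A}\otimes\mathcal{A}$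 if the span of $C_1$ and the block sums $\sum_{t\in T}C_t$ ($T$ a block of $\tau$) is closed under multiplication. *)

(* Defs.v *)
From mathcomp Require Export all_boot all_order all_algebra all_field.
From mathcomp Require Export sesquilinear reals complex.

Set Implicit Arguments.
Unset Strict Implicit.
Unset Printing Implicit Defensive.

Import Order.TTheory GRing.Theory Num.Theory.
Local Open Scope ring_scope.
Local Open Scope complex_scope.

Section TableAlgebra.
Variables (R : realType) (V : falgType R[i]).

Definition alg_char := {lrmorphism V -> R[i] | *%R}.

Definition str_const (A : 3.-tuple V) (i j h : 'I_3) : R[i] :=
  coord A h (A`_i * A`_j).

(* On R[i], 0 <= z means that z is real and nonnegative. *)
Record is_sym_rank3_SITA (A : 3.-tuple V) (delta : alg_char) : Prop := {
  sita_comm : commutative (@GRing.mul V);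
  sita_basis : basis_of fullv A;
  sita_one : A`_0 = 1;
  sita_ge0 : forall i j h : 'I_3, 0 <= str_const A i j h;
  sita_orth : forall i j : 'I_3, i != j -> str_const A i j ord0 = 0;
  sita_valency : forall i : 'I_3, str_const A i i ord0 = delta A`_i;
  sita_integral : forall i : 'I_3,
    exists2 m : nat, (0 < m)%N & delta A`_i = m%:R
}.

Definition is_character_table (A : 3.-tuple V) (delta : alg_char)
    (P : 'M[R[i]]_3) : Prop :=
  exists chi : 'I_3 -> alg_char,
    [/\ chi ord0 =1 delta,
        forall i j, chi i =1 chi j -> i = j,
        forall phi : alg_char, exists i, phi =1 chi i
      & forall i j : 'I_3, P i j = chi i A`_j].

End TableAlgebra.

Definition rank3_table (K : pzRingType) (k l r s : K) : 'M[K]_3 :=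
  \matrix_(i < 3, j < 3)
    nth 0 (nth [::] [:: [:: 1; k; l];
                        [:: 1; r; -1 - r];
                        [:: 1; s; -1 - s]] i) j.

(* The algebra T with the pure-tensor map t is the tensor square of V:
   t is the universal bilinear map on V x V, and the product of T is the
   componentwise one on pure tensors. *)
Record is_tensor_square (K : fieldType) (V T : falgType K)
    (t : {bilinear V -> V -> T}) : Prop := {
  tens_univ : forall (W : lmodType K) (f : {bilinear V -> V -> W}),
    exists g : {linear T -> W},
      (forall x y, g (t x y) = f x y) /\
      (forall g' : {linear T -> W},
         (forall x y, g' (t x y) = f x y) -> g' =1 g);
  tens_one : t 1 1 = 1;
  tens_mul : forall x y x' y', t x y * t x' y' = t (x * x') (y * y')
}.

Section Fusion.
Variables (K : fieldType) (V T : falgType K).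
Variables (A : 3.-tuple V) (t : {bilinear V -> V -> T}).

(* C_(3j+i+1) = A_i (x) A_j, for 0 <= i, j <= 2; only used for 1 <= m <= 9. *)
Definition tens_basis (m : nat) : T := t A`_(m.-1 %% 3) A`_(m.-1 %/ 3).

(* tau lists the blocks of a partition of {2, ..., 9}. *)
Definition is_partition_2_9 (tau : seq (seq nat)) : bool :=
  ([::] \notin tau) && perm_eq (flatten tau) (iota 2 8).

Definition fusion_space (tau : seq (seq nat)) : {vspace T} :=
  <<tens_basis 1 :: [seq (\sum_(m <- B) tens_basis m)%R | B <- tau]>>%VS.

Definition gives_fusion (tau : seq (seq nat)) : Prop :=
  is_partition_2_9 tau /\
  {in fusion_space tau &, forall x y, x * y \in fusion_space tau}.

End Fusion.

(* Main.v *)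
(* Put J = A_0 + A_1 + A_2.  Exchanging A_1 and A_2 turns case (ii) into case
   (i) with r replaced by -1 - s, so only (i) is needed.  The three characters
   separate the points of the algebra, because the character table has
   determinant (1 + k + l)(s - r) up to sign; hence the multiplication table
   and J x = delta(x) J can be checked on character values.  With X the first
   block sum and Y the second one, 1 + X + Y = J (x) J spans an ideal, so the
   closure of <1, X, Y> reduces to the single identity
   X^2 = (2 k + l^2) 1 + (r + 2)^2 X + 6 Y. *)
Require Import Defs.
From mathcomp Require Import ring.

Set Implicit Arguments.
Unset Strict Implicit.
Unset Printing Implicit Defensive.

Import GRing.Theory Num.Theory.
Local Open Scope ring_scope.
Local Open Scope complex_scope.

(** * Closure of a span under multiplication *)

Lemma span_closed_mul (K : fieldType) (T : falgType K) (s : seq T) :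
  {in s &, forall x y, x * y \in <<s>>%VS} ->
  {in <<s>>%VS &, forall x y, x * y \in <<s>>%VS}.
Proof.
move=> hs x y xs ys.
have mul_s u : u \in s -> u * y \in <<s>>%VS.
  move=> us; rewrite (coord_span (X := in_tuple s) ys) mulr_sumr rpred_sum // => i _.
  by rewrite -scalerAr rpredZ // hs // mem_nth.
rewrite (coord_span (X := in_tuple s) xs) mulr_suml rpred_sum // => i _.
by rewrite -scalerAl rpredZ // mul_s // mem_nth.
Qed.

Section Rank2Closure.
Variables (K : fieldType) (T : falgType K) (X Y : T).
Let W := <<[:: 1%R; X; Y]>>%VS.
Let J := 1 + X + Y.

(** Substituting [Y = J - 1 - X] expresses [X * Y], [Y * X] and then [Y * Y] through the four given
    products. [X] and [J] are not assumed to commute, so both orders occur. *)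
Lemma span3_closed_mul :
  X * J \in W -> J * X \in W -> J * Y \in W -> X * X \in W ->
  {in W &, forall x y, x * y \in W}.
Proof.
move=> XJ JX JY XX; apply: span_closed_mul.
have W1 : 1 \in W by apply: memv_span; rewrite !inE eqxx.
have WX : X \in W by apply: memv_span; rewrite !inE eqxx orbT.
have WY : Y \in W by apply: memv_span; rewrite !inE eqxx !orbT.
have XY : X * Y \in W.
  have -> : X * Y = X * J - X - X * X.
    by rewrite /J !mulrDr mulr1 -addrA -opprD addrC addKr.
  by rewrite !rpredB.
have YX : Y * X \in W.
  have -> : Y * X = J * X - X - X * X.
    by rewrite /J !mulrDl mul1r -addrA -opprD addrC addKr.
  by rewrite !rpredB.
have YY : Y * Y \in W.
  have -> : Y * Y = J * Y - Y - X * Y.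
    by rewrite /J !mulrDl mul1r -addrA -opprD addrC addKr.
  by rewrite !rpredB.
by move=> x y; rewrite !inE => /or3P[]/eqP-> /or3P[]/eqP->; rewrite ?mul1r ?mulr1.
Qed.

End Rank2Closure.

(** * The block sums in the tensor square *)

Section TensorSquare.
Variables (K : fieldType) (V T : falgType K) (t : {bilinear V -> V -> T}).
Hypothesis (t1 : t 1 1 = 1).
Hypothesis (tM : forall x y x' y', t x y * t x' y' = t (x * x') (y * y')).
Variables (a b : V).

(** Normal forms on 1, [a], [b] and on their nine pure tensors, grouped by the right factor: an
    identity between normal forms follows from equality of coefficients. *)
Let lin3 (c0 c1 c2 : K) : V := c0 *: 1 + c1 *: a + c2 *: b.
Let lin9 (c00 c10 c20 c01 c11 c21 c02 c12 c22 : K) : T :=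
  c00 *: t 1 1 + c10 *: t a 1 + c20 *: t b 1 +
  (c01 *: t 1 a + c11 *: t a a + c21 *: t b a) +
  (c02 *: t 1 b + c12 *: t a b + c22 *: t b b).

Lemma lin9D c0 c1 c2 c3 c4 c5 c6 c7 c8 d0 d1 d2 d3 d4 d5 d6 d7 d8 :
  lin9 c0 c1 c2 c3 c4 c5 c6 c7 c8 + lin9 d0 d1 d2 d3 d4 d5 d6 d7 d8 =
  lin9 (c0 + d0) (c1 + d1) (c2 + d2) (c3 + d3) (c4 + d4) (c5 + d5)
       (c6 + d6) (c7 + d7) (c8 + d8).
Proof.
have add3 (x y z x' y' z' : T) :
    x + y + z + (x' + y' + z') = (x + x') + (y + y') + (z + z').
  by rewrite addrACA (addrACA x).
by rewrite /lin9 add3; congr (_ + _ + _); rewrite add3 !scalerDl.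
Qed.

Lemma lin9Z e c0 c1 c2 c3 c4 c5 c6 c7 c8 :
  e *: lin9 c0 c1 c2 c3 c4 c5 c6 c7 c8 =
  lin9 (e * c0) (e * c1) (e * c2) (e * c3) (e * c4) (e * c5)
       (e * c6) (e * c7) (e * c8).
Proof. by rewrite /lin9 !scalerDr !scalerA. Qed.

Lemma tens_lin3 c0 c1 c2 d0 d1 d2 :
  t (lin3 c0 c1 c2) (lin3 d0 d1 d2) =
  lin9 (d0 * c0) (d0 * c1) (d0 * c2) (d1 * c0) (d1 * c1) (d1 * c2)
       (d2 * c0) (d2 * c1) (d2 * c2).
Proof.
rewrite /lin3 /lin9 !linearDr !linearDl !linearZr_LR !linearZl_LR /=.
by rewrite !scalerA.
Qed.

Lemma lin3_1 : 1 = lin3 1 0 0.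
Proof. by rewrite /lin3 !scale0r scale1r !addr0. Qed.
Lemma lin3_a : a = lin3 0 1 0.
Proof. by rewrite /lin3 !scale0r scale1r addr0 add0r. Qed.
Lemma lin3_b : b = lin3 0 0 1.
Proof. by rewrite /lin3 !scale0r scale1r !add0r. Qed.

Variables (r : K).
Let J := 1 + a + b.
(** The multiplication table of case (i), with [a], [b] as A_1, A_2: the coefficients interpolate
    the products of the character values (k, l), (r, -1 - r) and (-2, 1). *)
Hypothesis aaE : a * a = lin3 (r * (3 + r)) (r ^+ 2 + 2 * r - 2) (r ^+ 2 + r).
Hypothesis abE : a * b = lin3 0 (r + 1) (2 * r).
Hypothesis baE : b * a = lin3 0 (r + 1) (2 * r).
Hypothesis bbE : b * b = lin3 (3 + r) 2 (2 - r).

Let X := t a 1 + t 1 a + t b b.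
Let Y := t b 1 + t a a + t b a + t 1 b + t a b.
Let W := <<[:: 1; X; Y]%R>>%VS.

Lemma tens_XX :
  X * X = (2 * (r * (3 + r)) + (3 + r) ^+ 2) *: 1 + (r + 2) ^+ 2 *: X + 6 *: Y.
Proof.
(* Writing 1 as [t 1 1] puts both sides in the form [lin9], which leaves nine polynomial identities
   in [r]. *)
rewrite /X /Y -t1 !(mulrDl, mulrDr) !tM !(mulr1, mul1r) aaE abE baE bbE.
rewrite lin3_a lin3_b lin3_1 !tens_lin3 !(lin9D, lin9Z).
by congr lin9; ring.
Qed.

Hypothesis Ja : J * a = (r * (3 + r)) *: J.
Hypothesis Jb : J * b = (3 + r) *: J.
Hypothesis aJ : a * J = (r * (3 + r)) *: J.
Hypothesis bJ : b * J = (3 + r) *: J.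

Lemma tens_block_closed : {in W &, forall x y, x * y \in W}.
Proof.
(* All nine pure tensors occur exactly once in this sum. *)
have JE : 1 + X + Y = t J J.
  rewrite /X /Y /J -t1 lin3_a lin3_b lin3_1 /J.
  have -> : lin3 1 0 0 + lin3 0 1 0 + lin3 0 0 1 = lin3 1 1 1.
    by rewrite -lin3_1 -lin3_a -lin3_b /lin3 !scale1r.
  by rewrite !tens_lin3 !lin9D; congr lin9; ring.
have W1 : 1 \in W by apply: memv_span; rewrite !inE eqxx.
have WX : X \in W by apply: memv_span; rewrite !inE eqxx orbT.
have WY : Y \in W by apply: memv_span; rewrite !inE eqxx !orbT.
have WJ : t J J \in W by rewrite -JE (rpredD (rpredD W1 WX) WY).
have JZ c d : t (c *: J) (d *: J) \in W.
  by rewrite linearZl_LR linearZr_LR /= !rpredZ.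
have JZl c : t (c *: J) J \in W.
  by rewrite linearZl_LR /= rpredZ.
have JZr d : t J (d *: J) \in W.
  by rewrite linearZr_LR /= rpredZ.
apply: span3_closed_mul; rewrite ?JE.
- by rewrite /X !mulrDl !tM !mul1r aJ bJ !rpredD.
- by rewrite /X !mulrDr !tM !mulr1 Ja Jb !rpredD.
- by rewrite /Y !mulrDr !tM !mulr1 Ja Jb !rpredD.
- by rewrite tens_XX (rpredD (rpredD (rpredZ _ W1) (rpredZ _ WX)) (rpredZ _ WY)).
Qed.

End TensorSquare.

(** * Identities checked on character values *)

Section Characters.
Variables (K : fieldType) (V : falgType K).

Lemma char_lin3 (phi : {lrmorphism V -> K | *%R}) (a b : V) (c0 c1 c2 : K) :
  phi (c0 *: 1 + c1 *: a + c2 *: b) = c0 + c1 * phi a + c2 * phi b.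
Proof. by rewrite !linearD !linearZ_LR /= rmorph1 mulr1. Qed.

Lemma rank3_char_separate (A : 3.-tuple V) (phi0 phi1 phi2 : {lrmorphism V -> K | *%R})
    (k l r s : K) :
  basis_of fullv A -> A`_0 = 1 ->
  phi0 A`_1 = k -> phi0 A`_2 = l ->
  phi1 A`_1 = r -> phi1 A`_2 = -1 - r ->
  phi2 A`_1 = s -> phi2 A`_2 = -1 - s ->
  1 + k + l != 0 -> ~ phi1 =1 phi2 ->
  forall x y, phi0 x = phi0 y -> phi1 x = phi1 y -> phi2 x = phi2 y -> x = y.
Proof.
move=> bA A0 k0 l0 r1 r1' s2 s2' n0 ne12.
have lin x : exists c0 c1 c2, x = c0 *: 1 + c1 *: A`_1 + c2 *: A`_2.
  have := coord_basis bA (memvf x); rewrite !big_ord_recl big_ord0 /= A0 addr0 addrA.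
  by move=> E; do 3!eexists; exact: E.
(* If r = s, then [phi1] and [phi2] agree on a basis. *)
have rs : r - s != 0.
  apply/eqP => /subr0_eq rs; apply: ne12 => x.
  by have [c0 [c1 [c2 ->]]] := lin x; rewrite !char_lin3 r1 r1' s2 s2' rs.
move=> x y e0 e1 e2; apply/subr0_eq; move: (lin (x - y)) => [c0 [c1 [c2 E]]].
have f0 : phi0 (x - y) = 0 by rewrite linearB /= e0 subrr.
have f1 : phi1 (x - y) = 0 by rewrite linearB /= e1 subrr.
have f2 : phi2 (x - y) = 0 by rewrite linearB /= e2 subrr.
move: f0 f1 f2; rewrite E !char_lin3 k0 l0 r1 r1' s2 s2' => f0 f1 f2.
(* [phi1 - phi2] takes the value (c1 - c2)(r - s). Once c1 = c2, [phi1] gives c0 - c2, and then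
   [phi0] gives c2 (1 + k + l). *)
have c12 : c1 = c2.
  apply/eqP; rewrite -subr_eq0 -(mulIr_eq0 _ (mulIf rs)); apply/eqP.
  by rewrite -(subrr 0) -{1}f1 -f2; ring.
have c02 : c0 = c2.
  by apply/subr0_eq; rewrite -f1 c12; ring.
have c20 : c2 = 0.
  apply/eqP; rewrite -(mulIr_eq0 _ (mulIf n0)); apply/eqP.
  by rewrite -f0 c12 c02; ring.
by rewrite c12 c02 c20 !scale0r !addr0.
Qed.

Variables (T : falgType K) (t : {bilinear V -> V -> T}).

Lemma char_block_closed (phi0 phi1 phi2 : {lrmorphism V -> K | *%R})
    (a b : V) (r : K) :
  t 1 1 = 1 ->
  (forall x y x' y', t x y * t x' y' = t (x * x') (y * y')) ->
  (forall x y, phi0 x = phi0 y -> phi1 x = phi1 y -> phi2 x = phi2 y -> x = y) ->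
  phi0 a = r * (3 + r) -> phi0 b = 3 + r ->
  phi1 a = r -> phi1 b = -1 - r ->
  phi2 a = - 2 -> phi2 b = 1 ->
  let W := <<[:: 1; t a 1 + t 1 a + t b b;
                 t b 1 + t a a + t b a + t 1 b + t a b]%R>>%VS in
  {in W &, forall x y, x * y \in W}.
Proof.
move=> t1 tM sep a0 b0 a1 b1 a2 b2.
by apply: (tens_block_closed t1 tM (r := r)); apply: sep;
  rewrite ?(linearZ_LR, rmorphM, linearD, rmorph1) /=
    ?(linearZ_LR, rmorphM, linearD, rmorph1) /= ?a0 ?b0 ?a1 ?b1 ?a2 ?b2; ring.
Qed.

End Characters.

Theorem theorem4p6 (R : realType) (V : falgType R[i]) (A : 3.-tuple V)
    (delta : alg_char V) (k l r s : R[i])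
    (T : falgType R[i]) (t : {bilinear V -> V -> T})
    (hA : is_sym_rank3_SITA A delta)
    (hP : is_character_table A delta (rank3_table k l r s))
    (hT : is_tensor_square t) :
  (k = r * (3 + r) -> l = 3 + r -> s = - 2 ->
     gives_fusion A t [:: [:: 2; 4; 9]; [:: 3; 5; 6; 7; 8]]%N) /\
  (l = - k * (s + 1) -> k = 2 - s -> r = 1 ->
     gives_fusion A t [:: [:: 2; 4; 6; 8; 9]; [:: 3; 5; 7]]%N).
Proof.
have [_ bA A0 _ _ _ hint] := hA.
have [chi [chi0 chiI _ hchi]] := hP.
have [_ t1 tM] := hT.
pose i1 : 'I_3 := inord 1; pose i2 : 'I_3 := inord 2.
have v1 : i1 = 1%N :> nat by rewrite /i1 inordK.
have v2 : i2 = 2%N :> nat by rewrite /i2 inordK.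
have chiE (i j : 'I_3) : chi i A`_j = rank3_table k l r s i j by rewrite hchi.
have := (chiE ord0 i1, chiE ord0 i2, (chiE i1 i1, chiE i1 i2), (chiE i2 i1, chiE i2 i2)).
rewrite !mxE v1 v2 /= => -[[[k0 l0] [r1 r1']] [s2 s2']].
have n0 : 1 + k + l != 0.
  (* Valencies are natural numbers, so the sum is the image of a positive integer in characteristic
     0. *)
  have [p _ pk] := hint i1; have [q _ ql] := hint i2.
  rewrite v1 in pk; rewrite v2 in ql.
  by rewrite -k0 -l0 !chi0 pk ql (_ : 1 = 1%:R) // -!natrD pnatr_eq0.
have ne12 : ~ chi i1 =1 chi i2.
  by move=> /chiI /(congr1 (@nat_of_ord 3)) /=; rewrite v1 v2.
have sep := rank3_char_separate bA A0 k0 l0 r1 r1' s2 s2' n0 ne12.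
split=> [kE lE sE | lE kE rE]; split=> //.
  rewrite /fusion_space /= !big_cons !big_nil /tens_basis /= A0 t1 !addr0 !addrA.
  apply: (char_block_closed t1 tM sep (r := r)) => //.
  - by rewrite k0.
  - by rewrite l0.
  - by rewrite s2.
  - by rewrite s2' sE; ring.
have -> : fusion_space A t [:: [:: 2; 4; 6; 8; 9]; [:: 3; 5; 7]]%N =
  <<[:: 1; t A`_2 1 + t 1 A`_2 + t A`_1 A`_1;
         t A`_1 1 + t A`_2 A`_2 + t A`_1 A`_2 + t 1 A`_1 + t A`_2 A`_1]%R>>%VS.
  rewrite /fusion_space /= !big_cons !big_nil /tens_basis /= A0 t1 !addr0.
  (* The two spanning lists differ only in the order of the blocks and of the summands. *)
  set X := _ + (_ + (_ + _)); set Y := _ + (_ + _).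
  apply: eq_span => x; rewrite !inE.
  have -> : t A`_2 1 + t 1 A`_2 + t A`_1 A`_1 = Y by rewrite /Y addrAC addrA.
  suff -> : t A`_1 1 + t A`_2 A`_2 + t A`_1 A`_2 + t 1 A`_1 + t A`_2 A`_1 = X.
    by rewrite (orbC (x == X)).
  by rewrite /X !addrA [LHS](ACl (1*4*5*3*2)) /=.
(* The nontrivial characters trade places too: since r = 1, it is [chi i1] that takes the values -2
   at A_2 and 1 at A_1. *)
have sep' x y : chi ord0 x = chi ord0 y -> chi i2 x = chi i2 y ->
    chi i1 x = chi i1 y -> x = y by move=> *; exact: sep.
apply: (char_block_closed t1 tM sep' (r := -1 - s)) => //.
- by rewrite l0 lE kE; ring.
- by rewrite k0 kE; ring.
- by rewrite s2; ring.
- by rewrite r1' rE; ring.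
- by rewrite r1 rE.
Qed.
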